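(* Consider the Diophantine equation $$L_{n_1}L_{n_2}L_{n_3}\cdots L_{n_k}-1 = F_m^2$$ in integers $m\geq 0$, $k\geq 1$, and $0\leq n_1\leq n_2 \leq \cdots \leq n_k$. For a given $m\ge 0$, it has a solution if and only if $0\leq m\leq 2$. Moreover, the nontrivial solutions are exactly those given by $L_1-1 = F_0^2$, $L_0-1 = F_1^2$, and $L_0-1 = F_2^2$.
   Context: $(F_n)_{n\ge 0}$ is the Fibonacci sequence: $F_0=0$, $F_1=1$, $F_n=F_{n-1}+F_{n-2}$ for $n\ge 2$. $(L_n)_{n\ge 0}$ is the Lucas sequence: $L_0=2$, $L_1=1$, $L_n=L_{n-1}+L_{n-2}$ for $n\ge 2$. A solution is a tuple $(m,k,n_1,\dots,n_k)$; the indices $n_i$ need not be distinct. A solution is called nontrivial if either $k=1$, or $k\geq 2$ and $n_j\neq 1$ for every $j\in\{1,2,\ldots,k\}$. *)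

(* Defs.v *)
From mathcomp Require Import all_boot all_order all_algebra.

Set Implicit Arguments.
Unset Strict Implicit.
Unset Printing Implicit Defensive.

Import GRing.Theory Num.Theory.

Fixpoint fib (n : nat) : nat :=
  match n with
  | 0 => 0
  | 1 => 1
  | (n''.+1 as n').+1 => fib n' + fib n''
  end.

Fixpoint lucas (n : nat) : nat :=
  match n with
  | 0 => 2
  | 1 => 1
  | (n''.+1 as n').+1 => lucas n' + lucas n''
  end.

(* The equation is read in int, so that the subtraction is not truncated.     *)
Definition is_solution (m k : nat) (n : k.-tuple nat) : Prop :=
  [/\ 0 < k, sorted leq n &
      (\prod_(i < k) (lucas (tnth n i))%:Z - 1 = (fib m)%:Z ^+ 2)%R].

Definition nontrivial (k : nat) (n : k.-tuple nat) : Prop :=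
  k = 1 \/ (2 <= k /\ forall j : 'I_k, tnth n j <> 1).

(* Main.v *)
Require Import Defs.
From mathcomp Require Import all_boot all_order all_algebra zify ring.

Set Implicit Arguments.
Unset Strict Implicit.
Unset Printing Implicit Defensive.

(** [F_m^2 + 1] is a product [F_a F_b] with [a] and [b] odd. For odd [a], a
    common divisor of [F_a] and [L_n] divides [F_a] and [F_(2n) = F_n L_n], hence
    [F_(gcd (a, 2n)) = F_(gcd (a, n))], hence [F_n]; since [L_n = F_n + 2 F_(n-1)],
    it divides 2. So every [L_n] dividing [F_m^2 + 1] divides 4, and [-1] is not a
    square mod 4, which leaves [L_n] = 1 or 2 and a product at most 2. *)

Lemma fibSS n : fib n.+2 = fib n.+1 + fib n.
Proof. by []. Qed.

Lemma lucasSS n : lucas n.+2 = lucas n.+1 + lucas n.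
Proof. by []. Qed.

Lemma fib_add m n : fib (m + n).+1 = fib m.+1 * fib n.+1 + fib m * fib n.
Proof.
elim: m n => [|m IHm] n; first by rewrite mul1n addn0.
by rewrite addSnnS IHm !fibSS; ring.
Qed.

Lemma coprime_fib n : coprime (fib n) (fib n.+1).
Proof.
elim: n => [|n IHn] //.
by rewrite fibSS /coprime gcdnDl gcdnC.
Qed.

(** Subtractive Euclidean algorithm on the indices: writing the larger one as [a.+1 + c], [fib_add]
    leaves [d %| fib a * fib c], and [d], a divisor of [fib a.+1], is coprime to [fib a]. *)
Lemma dvdn_fib_gcd d a b : d %| fib a -> d %| fib b -> d %| fib (gcdn a b).
Proof.
have [s] := ubnP (a + b); elim: s a b => // s IHs a b lt_ab.
wlog le_ab : a b lt_ab / a <= b.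
  move=> W; case: (leqP a b) => [|/ltnW le_ba] da db; first exact: W.
  by rewrite gcdnC; apply: W => //; rewrite addnC.
case: a le_ab lt_ab => [|a] le_ab lt_ab; first by rewrite gcd0n.
rewrite -(subnKC le_ab) in lt_ab *; move: (b - a.+1) lt_ab => c lt_ab da db.
rewrite gcdnDl; apply: IHs => //; first lia.
move: db; rewrite addSn fib_add (dvdn_addr _ (dvdn_mulr _ da)) Gauss_dvdr //.
by apply: coprime_dvdl da _; rewrite coprime_sym coprime_fib.
Qed.

Lemma lucasS n : lucas n.+1 = fib n.+1 + (fib n).*2.
Proof.
suff: lucas n.+1 = fib n.+1 + (fib n).*2 /\
      lucas n.+2 = fib n.+2 + (fib n.+1).*2 by case.
elim: n => [|n [IH1 IH2]] //.
by split; rewrite // lucasSS IH1 IH2 !fibSS; lia.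
Qed.

Lemma fib_double n : fib n.*2 = fib n * lucas n.
Proof.
case: n => [|n] //.
by rewrite doubleS -addnn -addnS fib_add lucasS fibSS; lia.
Qed.

Lemma dvdn_fib a b : a %| b -> fib a %| fib b.
Proof.
case/dvdnP=> q ->; elim: q => [|q IHq]; first by rewrite mul0n dvdn0.
case: a IHq => [|a] IHq; first by rewrite muln0.
rewrite mulSn addSn fib_add.
by apply: dvdn_add; [apply: dvdn_mulr | apply: dvdn_mull].
Qed.

Lemma dvdn2_fib_lucas d a n :
  odd a -> d %| fib a -> d %| lucas n -> d %| 2.
Proof.
move=> odd_a da dn.
have d2n : d %| fib n.*2 by rewrite fib_double dvdn_mull.
have := dvdn_fib_gcd da d2n.
rewrite -mul2n Gauss_gcdr ?coprimen2 // => dg.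
have dFn : d %| fib n := dvdn_trans dg (dvdn_fib (dvdn_gcdr a n)).
case: n dn dFn {d2n dg} => [|n] //.
rewrite lucasS => dL dF; move: dL.
rewrite dvdn_addr // -mul2n Gauss_dvdl //.
by apply: coprime_dvdl dF _; rewrite coprime_sym coprime_fib.
Qed.

(** Cassini's identity at even index and Catalan's, with shift 2, at odd index. For [x] = F_(2j+1)
    and [y] = F_(2j), everything reduces to x^2 = xy + y^2 + 1, so the induction needs only the
    first identity. *)
Lemma sqr_fibS_pair j :
  (fib j.*2.+2 ^ 2).+1 = fib j.*2.+1 * fib j.*2.+3 /\
  (fib j.*2.+3 ^ 2).+1 = fib j.*2.+1 * fib j.*2.+4.+1.
Proof.
elim: j => [|j [IH _]] //; move: IH; rewrite doubleS !fibSS.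
move: (fib j.*2.+1) (fib j.*2) => x y; nia.
Qed.

Lemma sqr_fibS_factor m :
  exists a b, [/\ odd a, odd b & (fib m ^ 2).+1 = fib a * fib b].
Proof.
(* The pair of identities starts at index 2; below it, 1 = F_1 F_1 and 2 = F_1 F_3. *)
case: m => [|[|m]]; [by exists 1, 1 | by exists 1, 3 |].
rewrite -(odd_double_half m); have [E O] := sqr_fibS_pair m./2.
case: (odd m); [exists m./2.*2.+1, m./2.*2.+4.+1 | exists m./2.*2.+1, m./2.*2.+3];
  by rewrite /= odd_double ?add0n ?add1n; split.
Qed.

Lemma sqrS_ndvd4 x : ~~ (4 %| (x ^ 2).+1).
Proof.
rewrite -(odd_double_half x) -mul2n; case: (odd x); apply/negP => /dvdnP[q]; nia.
Qed.

Lemma lucas_ge3 n : 1 < n -> 2 < lucas n.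
Proof.
case: n => [|[|n]] // _; suff: 2 < lucas n.+2 /\ 0 < lucas n.+1 by case.
by elim: n => [|n [IH1 IH2]] //; rewrite lucasSS; lia.
Qed.

Lemma lucas_dvd_sqr_fibS n m : lucas n %| (fib m ^ 2).+1 -> n <= 1.
Proof.
move=> dL; have [a [b [oa ob E]]] := sqr_fibS_factor m.
have d4 : lucas n %| 2 * 2.
  (* [lucas n] may divide neither factor alone. The product of the two gcds is the gcd of four
     products, each a multiple of [lucas n]; each gcd divides 2. *)
  have dgg : lucas n %| gcdn (fib a) (lucas n) * gcdn (fib b) (lucas n).
    rewrite muln_gcdl !muln_gcdr !dvdn_gcd -E dL.
    by rewrite !(dvdn_mull _ (dvdnn _)) dvdn_mulr.
  apply: dvdn_trans dgg _; apply: dvdn_mul.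
    by apply: (dvdn2_fib_lucas oa); [apply: dvdn_gcdl | apply: dvdn_gcdr].
  by apply: (dvdn2_fib_lucas ob); [apply: dvdn_gcdl | apply: dvdn_gcdr].
rewrite leqNgt; apply/negP => /lucas_ge3 L3.
have L4 := dvdn_leq (isT : 0 < 2 * 2) d4.
case: (ltngtP (lucas n) 4) => [L|L|L4'].
- have L3' : lucas n = 3 by lia.
  by rewrite L3' in d4.
- lia.
- by move: dL; rewrite L4' (negbTE (sqrS_ndvd4 _)).
Qed.

Lemma fib_ge2 m : 2 < m -> 1 < fib m.
Proof.
case: m => [|[|[|m]]] // _; suff: 1 < fib m.+3 /\ 0 < fib m.+2 by case.
by elim: m => [|m [IH1 IH2]] //; rewrite fibSS; lia.
Qed.

(** Moving the 1 to the right removes the subtraction, so that divisibility in [nat] applies. *)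
Lemma is_solutionE m k (n : k.-tuple nat) :
  is_solution m n <->
  [/\ 0 < k, sorted leq n & \prod_(x <- n) lucas x = (fib m ^ 2).+1].
Proof.
have prodE : (\prod_(i < k) (lucas (tnth n i))%:Z)%R
             = Posz (\prod_(x <- n) lucas x).
  rewrite big_tuple; elim/big_rec2: _ => // i y1 y2 _ ->.
  by rewrite PoszM.
by rewrite /is_solution prodE; split=> -[k0 n_sorted E]; split=> //; lia.
Qed.

Lemma prod_lucas_seq01 s :
  all (leq^~ 1) s -> \prod_(x <- s) lucas x = 2 ^ count_mem 0 s.
Proof.
elim: s => [|x s IHs] /=; first by rewrite big_nil.
rewrite big_cons => /andP[x1 /IHs ->].
by case: x x1 => [|[|x]] //= _; rewrite ?mul1n ?expnS.
Qed.

Lemma prod_lucas_sqr_fibS s m :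
  \prod_(x <- s) lucas x = (fib m ^ 2).+1 ->
  [/\ m <= 2, all (leq^~ 1) s & count_mem 0 s = (0 < m)].
Proof.
move=> E; have s01 : all (leq^~ 1) s.
  apply/allP => x xs; apply: (@lucas_dvd_sqr_fibS x m).
  by rewrite -E (big_rem x) //= dvdn_mulr.
have := E; rewrite prod_lucas_seq01 // => E2.
(* Two factors L_0 = 2 would make 4 divide F_m^2 + 1. *)
have c1 : count_mem 0 s <= 1.
  rewrite leqNgt; apply/negP => c2; have := sqrS_ndvd4 (fib m).
  by rewrite -E2 -[4]/(2 ^ 2) dvdn_exp2l.
have m2 : m <= 2.
  rewrite leqNgt; apply/negP => /fib_ge2 f2.
  by move: E2; case: (count_mem 0 s) c1 => [|[|c]] // _; nia.
split=> //; case: (count_mem 0 s) c1 E2 => [|[|c]] // _.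
  by case: m m2 {E} => [|[|[|m]]].
by case: m m2 {E} => [|[|[|m]]].
Qed.

Theorem theorem7 :
  (forall m : nat,
     (exists (k : nat) (n : k.-tuple nat), is_solution m n) <-> 0 <= m <= 2)
  /\
  (forall (m k : nat) (n : k.-tuple nat),
     (is_solution m n /\ nontrivial n) <->
     [\/ [/\ m = 0, k = 1 & n = [:: 1] :> seq nat],
         [/\ m = 1, k = 1 & n = [:: 0] :> seq nat]
       | [/\ m = 2, k = 1 & n = [:: 0] :> seq nat]]).
Proof.
(* The single index is 1 for [m = 0], as L_1 = 1, and 0 for [m] = 1 or 2, as L_0 = 2. *)
have sol m k (n : k.-tuple nat) :
  m <= 2 -> k = 1 -> n = [:: (m == 0 : nat)] :> seq nat -> is_solution m n.
  move=> m2 k1 nE; apply/is_solutionE; rewrite nE k1 big_seq1.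
  by case: m m2 {nE} => [|[|[|m]]].
split=> [m|m k n].
  split=> [[k [n /is_solutionE[_ _ /prod_lucas_sqr_fibS[]]]] //|/= m2].
  by exists 1, [tuple (m == 0 : nat)]; apply: sol.
split; last first.
  by case=> -[m_ k1 nE]; split; [apply: sol; rewrite ?m_|left|
     apply: sol; rewrite ?m_|left|apply: sol; rewrite ?m_|left].
case=> /is_solutionE[_ _ /prod_lucas_sqr_fibS[m2 n01 n0]] nt.
have sz := size_tuple n.
have k1 : k = 1.
  (* All indices are at most 1, so excluding 1 makes all [k >= 2] of them 0, while at most one can
     be 0. *)
  case: nt => [//|[k2 n1]]; suff : count_mem 0 n = k by case: (m) n0 => [|?]; lia.
  rewrite -[RHS]sz; apply/eqP; rewrite -all_count; apply/allP => x xn.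
  have [i xE] := tnthP _ _ xn; have := n1 i; rewrite -xE.
  by have := allP n01 _ xn; case: x {xn xE} => [|[|x]].
subst k; case: (tval n) sz n01 n0 => [|x [|y s]] //= _ /andP[x1 _].
case: m m2 => [|[|[|m]]] // _; case: x x1 => [|[|x]] // _ _.
- by constructor 1.
- by constructor 2.
- by constructor 3.
Qed.
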